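(* For every integer $m \geq 3$, let $\Delta_{2m}$ be the simplicial polytope polar to the $2 \times (2m+1)$ transportation polytope $P(\mathbf{a},\mathbf{b})$ with margins $\mathbf{a} = (2m+1,2m+1) \in \mathbb{R}^2$ and $\mathbf{b} = (2,2,\ldots,2) \in \mathbb{R}^{2m+1}$. Then $\Delta_{2m}$ is not weakly vertex-decomposable.
   Context: Simplicial complexes. A simplicial complex $\Delta$ on a (finite) vertex set $V$ is a collection of subsets of $V$, called faces, such that if $F \in \Delta$ and $G \subseteq F$ then $G \in \Delta$. The dimension of a face $F$ is $|F|-1$, and $\dim(\Delta)$ is the maximum dimension of a face of $\Delta$. A facet of $\Delta$ is a face that is maximal under inclusion, and $\Delta$ is pure if all its facets have the same dimension. For a face $\tau \in \Delta$, the antistar (deletion) is $\Delta - \tau = \{G \in \Delta : \tau \nsubseteq G\}$. Weak $k$-decomposability. Let $\Delta$ be a $(d-1)$-dimensional simplicial complex and let $0 \leq k \leq d-1$. Recursively, $\Delta$ is weakly $k$-decomposable if $\Delta$ is pure and either (1) $\Delta$ is a $(d-1)$-simplex (i.e. the complex of all subsets of a $d$-element set), or (2) there exists a face $\tau \in \Delta$ with $\dim(\tau) \leq k$ such that $\Delta - \tau$ is $(d-1)$-dimensional and weakly $k$-decomposable. Weakly vertex-decomposable means weakly $0$-decomposable. Transportation polytopes. For $\mathbf{a} = (a_1,\ldots,a_p) \in \mathbb{R}^p$ and $\mathbf{b} = (b_1,\ldots,b_n) \in \mathbb{R}^n$ (the margins), the $p \times n$ transportation polytope $P(\mathbf{a},\mathbf{b})$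 is the set of all real $p \times n$ matrices $X = (x_{i,j})$ with nonnegative entries such that $\sum_{i=1}^p x_{i,j} = b_j$ for all $1 \leq j \leq n$ and $\sum_{j=1}^n x_{i,j} = a_i$ for all $1 \leq i \leq p$. Polar. The polar (dual) of a simple polytope $P$ is taken within its affine hull and is a simplicial polytope; a simplicial polytope is identified with its boundary complex when speaking of weak vertex-decomposability. Combinatorially, the boundary complex of the polar of a simple polytope $P$ is the simplicial complex whose vertices are the facets of $P$ and whose faces are the sets of facets of $P$ that have a common point (the empty set being a face); its facets correspond to the vertices of $P$. *)

(* Defs.v *)
From HB Require Import structures.
From mathcomp Require Import all_boot all_order all_algebra finmap.
From mathcomp Require Import boolp classical_sets functions cardinality reals.

Set Implicit Arguments.
Unset Strict Implicit.
Unset Printing Implicit Defensive.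

Import Order.TTheory GRing.Theory Num.Theory.

Local Open Scope classical_set_scope.
Local Open Scope ring_scope.

Section Complexes.
Variable V : choiceType.
Implicit Types (D : set {fset V}) (F G t : {fset V}).

Definition simplicial_complex D : Prop :=
  finite_set D /\ forall F G, D F -> (G `<=` F)%fset -> D G.

(* The empty face has dimension -1. *)
Definition face_dim F : int := #|` F|%:Z - 1.

Definition has_dim D (d : int) : Prop :=
  (exists2 F, D F & face_dim F = d) /\ (forall F, D F -> face_dim F <= d).

Definition facet D F : Prop :=
  D F /\ forall G, D G -> (F `<=` G)%fset -> G = F.

Definition pure D : Prop :=
  forall F G, facet D F -> facet D G -> face_dim F = face_dim G.

Definition simplex D : Prop :=
  exists A : {fset V}, D = [set F | (F `<=` A)%fset].

Definition antistar D t : set {fset V} := [set G | D G /\ ~~ (t `<=` G)%fset].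

(* A simplex has the dimension of the complex by itself, so the parameter
   d - 1 of the recursive definition only occurs in the shedding step. *)
Inductive weakly_decomposable (k : nat) (D : set {fset V}) : Prop :=
| WeaklyDecomposableSimplex of pure D & simplex D
| WeaklyDecomposableShed (d : int) (t : {fset V}) of
    pure D & has_dim D d & D t & face_dim t <= k%:Z &
    has_dim (antistar D t) d & weakly_decomposable k (antistar D t).

Definition weakly_vertex_decomposable D : Prop := weakly_decomposable 0 D.

End Complexes.

Section Polytopes.
Variables (R : realType) (E : lmodType R).
Implicit Types (P F : set E).

(* Faces are cut out by valid linear inequalities; P itself and the empty set
   are the improper ones obtained from f = 0. *)
Definition polytope_face P F : Prop :=
  exists (f : {linear E -> R^o}) (c : R),
    (forall x, P x -> f x <= c) /\ F = P `&` [set x | f x = c].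

Definition proper_face P F : Prop := polytope_face P F /\ F <> P.

Definition polytope_facet P F : Prop :=
  proper_face P F /\ forall G, proper_face P G -> F `<=` G -> G = F.

(* Boundary complex of the polar of a simple polytope P: its vertices are the
   facets of P. The common point is automatically in P when S is nonempty, and
   the empty set is always a face. *)
Definition polar_complex P : set {fset (set E)} :=
  [set S | (forall F, F \in S -> polytope_facet P F) /\
           exists x : E, forall F, F \in S -> F x].

End Polytopes.

Definition transportation_polytope (R : realType) (p n : nat)
    (a : 'rV[R]_p) (b : 'rV[R]_n) : set 'M[R]_(p, n) :=
  [set X | (forall i j, 0 <= X i j) /\
           (forall j, \sum_(i < p) X i j = b 0 j) /\
           (forall i, \sum_(j < n) X i j = a 0 i)].

Section TransportationFacets.
Variables (R : realType) (p n : nat) (a : 'rV[R]_p) (b : 'rV[R]_n).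
Let P := transportation_polytope a b.
Let coord_face (ij : 'I_p * 'I_n) := P `&` [set X | X ij.1 ij.2 = 0].

Lemma transportation_facetP F : polytope_facet P F ->
  F = set0 \/ exists ij, F = coord_face ij.
Proof.
move=> [[[f [c [fle eF]]] FP] Fmax].
have [[z0 Fz0]|F0] := pselect (exists z, F z); last first.
  by left; apply/seteqP; split=> // x Fx; apply: F0; exists x.
right; apply: contrapT => nF; apply: FP.
have Fij ij : coord_face ij <> P -> ~ F `<=` coord_face ij.
  move=> nP FG; apply: nF; exists ij; apply/esym/Fmax => //; split=> //.
  have lf : linear (fun X : 'M[R]_(p, n) => (- X ij.1 ij.2 : R^o)).
    by move=> k X Y; rewrite !mxE opprD -mulrN.
  pose g := GRing.isLinear.Build R 'M[R]_(p, n) R^o *:%R _ lf.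
  pose G : {linear 'M[R]_(p, n) -> R^o} :=
    HB.pack (fun X : 'M[R]_(p, n) => (- X ij.1 ij.2 : R^o)) g.
  exists G, 0; split=> [X [X0 _]|]; first by rewrite /G /= oppr_le0.
  by apply/seteqP; split=> X [PX /= X0]; split=> //=;
    [rewrite X0 oppr0|apply/eqP; rewrite -oppr_eq0; apply/eqP].
have /choice[w wP] ij : exists w, F w /\ (coord_face ij <> P -> 0 < w ij.1 ij.2).
  have [e|/Fij ne] := pselect (coord_face ij = P); first by exists z0.
  have [w [Fw nw]] : exists w, F w /\ ~ coord_face ij w.
    apply: contrapT => h; apply: ne => w Fw.
    by apply: contrapT => nw; apply: h; exists w.
  have Pw : P w by move: Fw; rewrite eF => -[].
  exists w; split=> // _; rewrite lt_def (Pw.1 _ _) andbT.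
  by apply/eqP => w0; apply: nw.
have PF X : F X -> P X by rewrite eF => -[].
have fF X : F X -> f X = c by rewrite eF => -[].
pose N : R := (#|{: 'I_p * 'I_n}|.+1)%:R.
have N0 : N != 0 by rewrite pnatr_eq0.
pose s := z0 + \sum_ij w ij.
pose z := N^-1 *: s.
have sE i j : s i j = z0 i j + \sum_kl w kl i j by rewrite mxE summxE.
have Fpos X i j : F X -> 0 <= X i j by move/PF => -[/(_ i j)].
have z_ge0 i j : 0 <= z i j.
  rewrite mxE mulr_ge0 ?invr_ge0 ?ler0n// sE addr_ge0 ?Fpos// sumr_ge0// => kl _.
  exact/Fpos/(wP kl).1.
have z_gt0 ij : coord_face ij <> P -> 0 < z ij.1 ij.2.
  move=> h; rewrite mxE mulr_gt0 ?invr_gt0 ?ltr0Sn// sE ltr_wpDl ?Fpos//.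
  rewrite (bigD1 ij)//= ltr_pwDl ?(wP ij).2// sumr_ge0// => kl _.
  exact/Fpos/(wP kl).1.
have NE : N = 1 + \sum_(ij : 'I_p * 'I_n) 1 by rewrite sumr_const /N mulrSr addrC.
have fz : f z = c.
  rewrite linearZ linearD linear_sum /= fF// (eq_bigr (fun=> c)); last first.
    by move=> ij _; exact/fF/(wP ij).1.
  rewrite sumr_const; apply: (scalerI N0); rewrite scalerA divff// scale1r.
  by rewrite /N -mulrS scaler_nat.
have scN k : N^-1 * (k + \sum_(ij : 'I_p * 'I_n) k) = k.
  by rewrite sumr_const -mulrS -[_ *+ _]mulr_natl mulrA mulVf// mul1r.
have Pz : P z.
  split=> //; split=> [j|i].
    under eq_bigr do rewrite mxE sE.
    rewrite -mulr_sumr big_split/= exchange_big/= (PF _ Fz0).2.1.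
    under eq_bigr => kl _ do rewrite (PF _ (wP kl).1).2.1.
    exact: scN.
  under eq_bigr do rewrite mxE sE.
  rewrite -mulr_sumr big_split/= exchange_big/= (PF _ Fz0).2.2.
  under eq_bigr => kl _ do rewrite (PF _ (wP kl).1).2.2.
  exact: scN.
apply/seteqP; split=> [|y Py]; first exact: PF.
rewrite eF; split=> //; apply/eqP; rewrite eq_le fle//=.
pose S := \sum_(ij : 'I_p * 'I_n) y ij.1 ij.2 / z ij.1 ij.2.
have yz0 ij : 0 <= y ij.1 ij.2 / z ij.1 ij.2 by rewrite divr_ge0 ?Py.1.
have S0 : 0 <= S by rewrite sumr_ge0.
have S1 : 0 < 1 + S by rewrite ltr_pwDl.
pose e := (1 + S)^-1.
have e0 : 0 < e by rewrite invr_gt0.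
suff Pz' : P (z + e *: (z - y)).
  have fE : f (z + e *: (z - y)) = c + e * (c - f y).
    by rewrite [f _]linearD [f (e *: _)]linearZ_LR [f (z - y)]linearB -fz.
  by have := fle _ Pz'; rewrite fE gerDl pmulr_rle0// subr_le0.
have zyE i j : (z + e *: (z - y)) i j = z i j + e * (z i j - y i j).
  rewrite mxE; congr (_ + _); rewrite mxE; congr (_ * _).
  by rewrite mxE; congr (_ + _); rewrite mxE.
split=> [i j|].
  rewrite zyE; have [eP|nP] := pselect (coord_face (i, j) = P).
    have := Py; have := Pz; rewrite -eP => -[_ /= zz] [_ /= y0].
    by rewrite y0 zz subrr mulr0 addr0.
  have zp := z_gt0 _ nP; rewrite /= in zp.
  rewrite mulrBr addrCA addr_ge0 ?mulr_ge0 ?(ltW e0)// subr_ge0.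
  rewrite mulrC ler_pdivrMr// mulrC -ler_pdivrMr//.
  by rewrite /S (bigD1 (i, j))//= addrCA lerDl addr_ge0// sumr_ge0.
split=> [j|i]; under eq_bigr do rewrite zyE;
    rewrite big_split/= -mulr_sumr sumrB.
  by rewrite Pz.2.1 Py.2.1 subrr mulr0 addr0.
by rewrite Pz.2.2 Py.2.2 subrr mulr0 addr0.
Qed.

Lemma finite_transportation_facets : finite_set (polytope_facet P).
Proof.
apply: (@sub_finite_set _ _ ([set set0] `|` range coord_face)).
  by move=> F /transportation_facetP[->|[ij ->]]; [left|right; exists ij].
by rewrite finite_setU; split; [exact: finite_set1|exact/finite_image/finite_finset].
Qed.

Lemma polar_transportation_simplicial : simplicial_complex (polar_complex P).
Proof.
split=> [|S T [SP [x Sx]] /fsubsetP TS]; last first.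
  by split=> [F /TS/SP//|]; exists x => F /TS/Sx.
have /finite_fsetP[A eA] := finite_transportation_facets.
apply: (@sub_finite_set _ _ [set` fpowerset A]); last exact: finite_fset.
move=> S [SP _]; rewrite /= fpowersetE; apply/fsubsetP => F /SP FP.
by have : polytope_facet P F by []; rewrite eA.
Qed.

End TransportationFacets.

(* Main.v *)
(* Vertices of the complex are pairs (row i, column j), standing for the facet
   X i j = 0. A set of pairs is a face iff it meets each column at most once and
   each row at most m times, so facets have 2m elements. A shedding sequence can
   delete at most one vertex from each row: the deletion of a second vertex from
   a row destroys purity. Hence some column keeps both of its vertices, which do
   not form a face, and no simplex is ever reached. *)
From HB Require Import structures.
Require Import Defs.
From mathcomp Require Import all_boot all_order all_algebra finmap.
From mathcomp Require Import boolp classical_sets functions cardinality reals.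
From mathcomp Require Import lra zify.
From mathcomp Require Import fintype finset.

Set Implicit Arguments.
Unset Strict Implicit.
Unset Printing Implicit Defensive.

Import Order.TTheory GRing.Theory Num.Theory.

Local Open Scope ring_scope.

(** * Pure complexes, faces through positive points, subsets of given size *)

(** The bound [n] lets every face grow to a facet, and purity makes the facet above [F] as large as
    one above [E]. *)
Lemma pure_extend (V : choiceType) (D : set {fset V}) (n : nat) (F E : {fset V}) :
  pure D -> (forall F', D F' -> (#|` F'| <= n)%N) -> D F -> D E ->
  exists2 F', D F' & (F `<=` F')%fset /\ (#|` E| <= #|` F'|)%N.
Proof.
move=> pD bD; have extend G : D G -> exists2 G', facet D G' & (G `<=` G')%fset.
  have [k] := ubnP (n - #|` G|); elim: k G => // k IH G kG DG.
  have [fG|nfG] := pselect (facet D G); first by exists G.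
  have [G' [DG' GG' G'G]] : exists G', [/\ D G', (G `<=` G')%fset & G' <> G].
    apply: contrapT => h; apply: nfG; split=> // G' DG' GG'.
    by apply: contrapT => G'G; apply: h; exists G'.
  have /fproper_ltn_card cG : (G `<` G')%fset.
    by rewrite fproperEneq GG' andbT; apply/eqP => e; apply: G'G.
  have cG' := bD _ DG'; have [|//|G'' fG'' G'G''] := IH G'; first lia.
  by exists G'' => //; exact: fsubset_trans GG' G'G''.
move=> /extend[F' fF' FF'] /extend[E' fE' /fsubset_leq_card EE'].
exists F'; first exact: fF'.1.
split=> //; move: (pD _ _ fF' fE'); rewrite /face_dim; lia.
Qed.

(** From a positive [w] one can move a little away from any [y] in the polytope without leaving it.
    Validity of [f] at the new point then forces [f y] to be at least [c]. *)
Lemma interior_face (R : realType) (p n : nat) (a : 'rV[R]_p) (b : 'rV[R]_n)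
    (F : set 'M[R]_(p, n)) (w : 'M[R]_(p, n)) :
  polytope_face (transportation_polytope a b) F -> F w ->
  (forall i j, 0 < w i j) -> F = transportation_polytope a b.
Proof.
move=> [f [c [fle ->]]] [Pw /= fw] w0.
apply/seteqP; split=> [x []//|y Py]; split=> //=.
apply/eqP; rewrite eq_le fle//=.
(* The step length [(1 + S)^-1] is small enough that [e * y i j <= w i j] for all entries at
   once. *)
pose S := \sum_(ij : 'I_p * 'I_n) y ij.1 ij.2 / w ij.1 ij.2.
have yw0 ij : 0 <= y ij.1 ij.2 / w ij.1 ij.2 by rewrite divr_ge0 ?Py.1 ?ltW.
have S1 : 0 < 1 + S by rewrite ltr_pwDl// sumr_ge0.
have e0 : 0 < (1 + S)^-1 by rewrite invr_gt0.
set e := (1 + S)^-1 in e0.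
have zE i j : (w + e *: (w - y)) i j = w i j + e * (w i j - y i j).
  by rewrite !mxE.
suff /fle : transportation_polytope a b (w + e *: (w - y)).
  by rewrite linearD linearZ_LR linearB /= fw gerDl pmulr_rle0// subr_le0.
split=> [i j|].
  rewrite zE mulrBr addrCA addr_ge0 ?mulr_ge0 ?(ltW e0) ?(ltW (w0 _ _))//.
  rewrite subr_ge0 mulrC ler_pdivrMr// mulrC -ler_pdivrMr//.
  by rewrite /S (bigD1 (i, j))//= addrCA lerDl addr_ge0// sumr_ge0.
split=> [j|i]; under eq_bigr do rewrite zE; rewrite big_split/= -mulr_sumr sumrB.
  by rewrite Pw.2.1 Py.2.1 subrr mulr0 addr0.
by rewrite Pw.2.2 Py.2.2 subrr mulr0 addr0.
Qed.

Lemma subset_of_card (T : finType) (A : {set T}) k : (k <= #|A|)%N ->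
  exists2 B : {set T}, B \subset A & #|B| = k.
Proof.
elim: k => [|k IH] kA; first by exists set0; rewrite ?sub0set ?cards0.
have [B BA cB] := IH (ltnW kA).
have /properP[_ [x xA xB]] : B \proper A by rewrite properEcard BA cB.
exists (x |: B); first by rewrite subUset sub1set xA.
by rewrite cardsU1 xB cB.
Qed.

(** * Facets of the two-row transportation polytope *)

Section TwoRows.
Variables (R : realType) (m : nat).
Hypothesis m_gt1 : (1 < m)%N.
Let N := (2 * m + 1)%N.
Let P : set 'M[R]_(2, N) := transportation_polytope
  (const_mx (2 * m + 1)%:R : 'rV[R]_2) (const_mx 2%:R : 'rV[R]_(2 * m + 1)).
Let index := ('I_2 * 'I_N)%type.
Let C := polar_complex P.

Lemma sum_rows (f : 'I_2 -> R) i : \sum_k f k = f i + f (rev_ord i).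
Proof.
rewrite (bigD1 i)//= (bigD1 (rev_ord i))/= ?big1 ?addr0//.
  by move=> k; case: i k => [[|[|]]//= ?] [[|[|]]//= ?].
by case: i => [[|[|]]].
Qed.

Lemma card_columns : #|'I_N| = (2 * m + 1)%N.
Proof. exact: card_ord. Qed.

Lemma rows_col X i j : P X -> X i j + X (rev_ord i) j = 2.
Proof. by move=> [_ [/(_ j)]]; rewrite (sum_rows _ i) mxE. Qed.

(** Every column sums to 2, so row [i] alone determines a point; [v] is that row. *)
Definition row_point (i : 'I_2) (v : 'I_N -> R) : 'M[R]_(2, N) :=
  \matrix_(k, j) if k == i then v j else 2 - v j.

Lemma rev_ord_neq (i : 'I_2) : (rev_ord i == i) = false.
Proof. by case: i => [[|[|]]]. Qed.

Lemma ord2_neq (i k : 'I_2) : k != i -> k = rev_ord i.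
Proof.
by move=> ki; apply/val_inj; case: i k ki => [[|[|]]//= ?] [[|[|]]//= ?].
Qed.

Lemma row_point_polytope i v : (forall j, 0 <= v j <= 2) ->
  \sum_j v j = N%:R -> P (row_point i v).
Proof.
move=> v02 sv; split; [|split] => [k j|j|k].
- by rewrite mxE; have /andP[? ?] := v02 j; case: ifP => _ //; rewrite subr_ge0.
- by rewrite (sum_rows _ i) !mxE eqxx rev_ord_neq addrC subrK.
- rewrite !mxE; under eq_bigr do rewrite mxE; case: (k == i) => //.
  rewrite sumrB sv sumr_const card_ord -mulr_natl -/N; lra.
Qed.

Definition column_facet (p : index) : set 'M[R]_(2, N) :=
  (P `&` [set X : 'M[R]_(2, N) | X p.1 p.2 = 0])%classic.

Lemma facet_interior p : exists2 X, column_facet p X &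
  forall q, q != p -> 0 < X q.1 q.2.
Proof.
(* The row sum [N] is spread evenly over the [2 * m] columns other than [j]. Since
   [2 * m + 1 < 4 * m], the value [c] stays below 2 and the other row stays positive. *)
case: p => i j; pose c : R := N%:R / (2 * m)%:R.
have m0 : (2 * m)%:R != 0 :> R by rewrite pnatr_eq0; lia.
have c0 : 0 < c by rewrite divr_gt0 ?ltr0n//; lia.
have c2 : c < 2%:R.
  by rewrite ltr_pdivrMr ?ltr0n -?natrM ?ltr_nat /N; lia.
exists (row_point i (fun j' => if j' == j then 0 else c)).
  split; last by rewrite /= mxE !eqxx.
  apply: row_point_polytope => [j'|].
    by case: ifP => _; rewrite ?lexx ?ler0n// ?ltW.
  rewrite (bigD1 j)//= eqxx add0r (eq_bigr (fun=> c)); last by move=> k /negbTE->.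
  by rewrite sumr_const cardC1 card_ord -[LHS]mulr_natr /c /N addn1 divfK.
move=> [k l] /=; rewrite xpair_eqE mxE; case: ifP => /= _; case: ifP => //= _ _; lra.
Qed.

(** For maximality: if a face contains this one and a point [x] with nonzero entry at [p], then the
    midpoint of [x] and a point vanishing only at [p] is positive, so [interior_face] makes that
    face all of [P]. *)
Lemma column_facetP p : polytope_facet P (column_facet p).
Proof.
have [z Fz z0] := facet_interior p.
split.
  split.
    have lf : linear (fun X : 'M[R]_(2, N) => (- X p.1 p.2 : R^o)).
      by move=> k X Y; rewrite !mxE opprD -mulrN.
    pose g := GRing.isLinear.Build R 'M[R]_(2, N) R^o *:%R _ lf.
    pose f : {linear 'M[R]_(2, N) -> R^o} :=
      HB.pack (fun X : 'M[R]_(2, N) => (- X p.1 p.2 : R^o)) g.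
    exists f, 0; split=> [X [X0 _]|]; first by rewrite /f /= oppr_le0.
    by apply/seteqP; split=> X [PX /= X0]; split=> //=;
      [rewrite X0 oppr0|apply/eqP; rewrite -oppr_eq0; apply/eqP].
  have P1 : P (row_point p.1 (fun=> 1)).
    apply: row_point_polytope => [j|]; first by rewrite ler01 ler1n.
    by rewrite sumr_const card_ord.
  move=> e; move: P1; rewrite -e => -[_ /=].
  by rewrite mxE eqxx => /eqP; rewrite oner_eq0.
move=> F [fF FP] sF; apply/seteqP; split=> // x Fx.
have [f [c [fle eF]]] := fF.
have Px : P x by move: Fx; rewrite eF => -[].
split=> //=; apply: contrapT => /eqP xp; apply: FP.
have Pz : P z := Fz.1.
have xz i j : (2^-1 *: (x + z)) i j = 2^-1 * (x i j + z i j) by rewrite !mxE.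
apply: (@interior_face _ _ _ _ _ _ (2^-1 *: (x + z))) => // [|i j].
  have /sF := Fz; move: Fx; rewrite eF => -[_ /= fx] [_ /= fz].
  split; last by rewrite /= linearZ_LR linearD fx fz /= /GRing.scale/=; lra.
  split=> [i j|].
    by rewrite xz mulr_ge0 ?addr_ge0 ?Px.1 ?Pz.1// invr_ge0 ler0n.
  split=> [j|i]; under eq_bigr do rewrite xz; rewrite -mulr_sumr big_split/=.
    by rewrite Px.2.1 Pz.2.1; lra.
  by rewrite Px.2.2 Pz.2.2; lra.
rewrite xz mulr_gt0 ?invr_gt0 ?ltr0n//.
have [e|ne] := eqVneq (i, j) p; last by rewrite ltr_wpDl ?Px.1// (z0 _ ne).
by rewrite ltr_pwDl ?Pz.1// lt_neqAle eq_sym Px.1 andbT; move: xp; rewrite -e.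
Qed.

Lemma column_facet_inj : injective column_facet.
Proof.
move=> p q e; apply: contrapT => /eqP pq.
have [z Fz z0] := facet_interior p.
have := z0 q; rewrite eq_sym => /(_ pq).
by move: Fz; rewrite e => -[_ /= ->]; rewrite ltxx.
Qed.

(** * Faces of the polar complex as sets of index pairs *)

Definition face_of (A : {set index}) : {fset set 'M[R]_(2, N)} :=
  [fset column_facet p | p in A]%fset.

Lemma mem_face_of A p : (column_facet p \in face_of A) = (p \in A).
Proof.
apply/imfsetP/idP => [[q /= qA /column_facet_inj->//]|pA]; by exists p.
Qed.

Lemma card_face_of (A : {set index}) : #|` face_of A| = #|A|.
Proof.
rewrite card_imfset/=; last exact: column_facet_inj.
by rewrite -cardE.
Qed.

(** This moves all counting to the finite type of index pairs. The empty candidate left open by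
    [transportation_facetP] is excluded because the common point lies in each member of [S]. *)
Lemma polarE S : C S -> S = face_of [set p | column_facet p \in S].
Proof.
move=> [Sf [x Sx]]; apply/fsetP => F; apply/idP/imfsetP => [FS|[p /= pS ->]].
  have /transportation_facetP[F0|[p eF]] := Sf _ FS.
    by have := Sx _ FS; rewrite F0.
  by exists p => //=; rewrite inE; move: FS; rewrite eF.
by move: pS; rewrite inE.
Qed.

Lemma polar_sub (A B : {set index}) : A \subset B -> C (face_of B) -> C (face_of A).
Proof.
move=> /subsetP AB [Bf [x Bx]].
have sAB F : F \in face_of A -> F \in face_of B.
  by move=> /imfsetP[p /= /AB pB ->]; rewrite mem_face_of.
by split; [move=> F /sAB/Bf|exists x => F /sAB/Bx].
Qed.

(** Two entries with sum 2 cannot both vanish. *)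
Lemma polar_column (A : {set index}) i j :
  C (face_of A) -> (i, j) \in A -> (rev_ord i, j) \notin A.
Proof.
move=> [_ [x Ax]] iA; apply/negP => kA.
have [Px /= xi] : column_facet (i, j) x by apply: Ax; rewrite mem_face_of.
have [_ /= xk] : column_facet (rev_ord i, j) x by apply: Ax; rewrite mem_face_of.
by have /eqP := rows_col i j Px; rewrite xi xk addr0 eq_sym pnatr_eq0.
Qed.

Definition row_of (A : {set index}) (i : 'I_2) : {set 'I_N} := [set j | (i, j) \in A].

Lemma card_rows (A : {set index}) i : #|A| = (#|row_of A i| + #|row_of A (rev_ord i)|)%N.
Proof.
rewrite -(cardsID [set p | p.1 == i] A); congr addn.
  rewrite -[RHS](@card_imset _ _ (pair i)); last by move=> ? ? [].
  apply: eq_card => -[k j]; rewrite !inE /=; apply/andP/imsetP.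
    by move=> [kA /eqP ki]; subst k; exists j; rewrite ?inE.
  by move=> [j']; rewrite inE => jA [-> ->]; rewrite eqxx.
rewrite -[RHS](@card_imset _ _ (pair (rev_ord i))); last by move=> ? ? [].
apply: eq_card => -[k j]; rewrite !inE /=; apply/andP/imsetP.
  by move=> [/ord2_neq-> kA]; exists j; rewrite ?inE.
by move=> [j']; rewrite inE => jA [-> ->]; rewrite rev_ord_neq.
Qed.

(** Entries are at most 2 and the row sums to [2 * m + 1], so at least [m + 1] of them are
    nonzero. *)
Lemma polar_row (A : {set index}) i : C (face_of A) -> (#|row_of A i| <= m)%N.
Proof.
(* A common point is known to lie in [P] only through some facet that contains it, so an empty row
   is treated apart. *)
have [->|/set0Pn[j0]] := eqVneq (row_of A i) set0; first by rewrite cards0.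
rewrite inE => j0A [_ [x Ax]].
have [Px _] : column_facet (i, j0) x by apply: Ax; rewrite mem_face_of.
have x0 j : j \in row_of A i -> x i j = 0.
  by rewrite inE => jA; have [] : column_facet (i, j) x by apply: Ax; rewrite mem_face_of.
have : (N%:R : R) <= (2 * #|~: row_of A i|)%:R.
  have <- : \sum_j x i j = N%:R by rewrite Px.2.2 mxE.
  rewrite (bigID (mem (row_of A i)))/= big1 ?add0r; last by move=> j /x0.
  rewrite natrM mulr_natr -sumr_const.
  rewrite [leRHS](eq_bigl (fun j => j \notin row_of A i)); last by move=> j; rewrite !inE.
  apply: ler_sum => j _.
  by rewrite -(rows_col i j Px) lerDl Px.1.
rewrite ler_nat; have := cardsC (row_of A i); rewrite card_columns; lia.
Qed.

(** The source of all explicit faces below: sizes [m] give facets, sizes 1 give single vertices. *)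
Lemma polar_pair (A B : {set 'I_N}) i : [disjoint A & B] -> #|A| = #|B| ->
  C (face_of [set p | p.2 \in (if p.1 == i then A else B)]).
Proof.
move=> dAB cAB; split=> [F /imfsetP[p _ ->]|]; first exact: column_facetP.
have jAB j : j \in B -> (j \in A) = false.
  by move=> jB; apply/negP => jA; move/pred0P/(_ j): dAB; rewrite /= jA jB.
(* Row [i] is 0 on [A], 2 on [B] and 1 elsewhere, so the other row vanishes on [B]; equal sizes keep
   the row sum at [N]. *)
pose v j : R := 1 + (j \in B)%:R - (j \in A)%:R.
have Pv : P (row_point i v).
  apply: row_point_polytope => [j|].
    rewrite /v; case: (boolP (j \in B)) => [/jAB->|_].
      by rewrite /=; apply/andP; split; lra.
    by case: (j \in A); rewrite /=; apply/andP; split; lra.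
  have sumX (X : {set 'I_N}) : \sum_j (j \in X)%:R = #|X|%:R :> R.
    rewrite -sum1_card natr_sum [RHS]big_mkcond.
    by apply: eq_bigr => j _; case: (j \in X).
  by rewrite /v sumrB big_split/= !sumX cAB addrK sumr_const card_ord.
exists (row_point i v) => F /imfsetP[[k j] /= kj ->]; split=> //=.
move: kj; rewrite inE mxE /v /=; case: ifP => _ jX.
  rewrite jX; case: (boolP (j \in B)) => [/jAB|_]; rewrite ?jX/=; lra.
rewrite jX jAB//=; lra.
Qed.

(** * Deleting vertices and purity *)

(* [r i] collects the columns [j] for which the vertex [(i, j)] is deleted. *)
Definition remaining (r : 'I_2 -> {set 'I_N}) : set {fset set 'M[R]_(2, N)} :=
  [set S | C S /\ forall i j, j \in r i -> column_facet (i, j) \notin S]%classic.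

Lemma remaining_card r S : remaining r S -> (#|` S| <= 2 * m)%N.
Proof.
move=> [CS _]; have eS := polarE CS; move: CS; rewrite eS => CS.
rewrite card_face_of (card_rows _ ord0).
have := polar_row ord0 CS; have := polar_row (rev_ord ord0) CS; lia.
Qed.

(* If two vertices are gone from row [i] and at most one from the other row,
   the other row contains a face on [m] untouched columns, to which row [i] can
   add at most [2m + 1 - m - 2 = m - 1] vertices. *)
Lemma pure_remaining r i S : pure (remaining r) ->
  remaining r S -> (2 * m <= #|` S|)%N ->
  (#|r i| + #|r (rev_ord i)| <= 3)%N -> (#|r i| <= 1)%N.
Proof.
move=> pr rS cS r3; rewrite leqNgt; apply/negP => r2.
(* At most 3 columns are touched, and [2 * m + 1 - 3 >= m] because [m >= 2]. *)
have [B BU cB] : exists2 B : {set 'I_N}, B \subset ~: (r i :|: r (rev_ord i))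
    & #|B| = m.
  apply: subset_of_card.
  have := cardsC (r i :|: r (rev_ord i)).
  have := cardsU (r i) (r (rev_ord i)); rewrite card_columns; lia.
have [A AB cA] : exists2 A : {set 'I_N}, A \subset ~: B & #|A| = m.
  by apply: subset_of_card; have := cardsC B; rewrite card_columns; lia.
have CAB : C (face_of [set p | p.2 \in (if p.1 == i then A else B)]).
  by apply: polar_pair; [rewrite disjoints_subset|rewrite cA cB].
pose E : {set index} := [set p | (p.1 == rev_ord i) && (p.2 \in B)].
have rE : remaining r (face_of E).
  split; first apply: polar_sub CAB.
    apply/subsetP => -[k j]; rewrite !inE /= => /andP[/eqP-> jB].
    by rewrite rev_ord_neq.
  move=> k j jr; rewrite mem_face_of inE /=; apply/negP => /andP[/eqP ki].
  by move=> /(subsetP BU); rewrite !inE -ki jr orbT.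
have [T rT [ET ST]] := pure_extend pr (@remaining_card r) rE rS.
have eT := polarE rT.1; set D := [set p | _] in eT.
have CD : C (face_of D) by rewrite -eT; exact: rT.1.
have rD : row_of D i \subset ~: (B :|: r i).
  apply/subsetP => j; rewrite !inE => jT; apply/negP => /orP[jB|jr]; last first.
    by have := rT.2 _ _ jr; rewrite jT.
  have := @polar_column D i j CD; rewrite !inE => /(_ jT) /negP; apply.
  by apply: (fsubsetP ET); rewrite mem_face_of inE eqxx.
have := cardsC (B :|: r i); have := cardsU B (r i).
have -> : B :&: r i = set0.
  apply/setP => j; rewrite !inE; apply/negP => /andP[/(subsetP BU)].
  by rewrite !inE => /norP[/negbTE->].
have := subset_leq_card rD; have := polar_row (rev_ord i) CD.
move: cS ST; rewrite eT card_face_of (card_rows D i) cards0 cB card_columns; lia.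
Qed.

Lemma polar_vertex p : C (face_of [set p]).
Proof.
case: p => i j.
(* A second vertex, in the other row and another column, balances the sizes for [polar_pair]. *)
have /set0Pn[j'] : [set~ j] != set0 by rewrite -card_gt0 cardsC1 card_columns; lia.
rewrite !inE => j'j.
apply: (@polar_sub _ [set p | p.2 \in if p.1 == i then [set j] else [set j']]).
  by rewrite sub1set inE /= eqxx inE.
apply: polar_pair; last by rewrite !cards1.
by rewrite disjoints1 inE eq_sym.
Qed.

Lemma sub_face_of (A : {set index}) S :
  (face_of A `<=` S)%fset = [forall p in A, column_facet p \in S].
Proof.
apply/fsubsetP/forall_inP => [AS p pA|AS _ /imfsetP[p /= pA ->]]; last exact: AS.
by apply: AS; rewrite mem_face_of.
Qed.

Lemma remaining_not_simplex (r : 'I_2 -> {set 'I_N}) :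
  (forall i, #|r i| <= 1)%N -> ~ simplex (remaining r).
Proof.
move=> r1 [A eA].
(* At most two of the [2 * m + 1] columns are touched. *)
have [j jr] : exists j, j \notin r ord0 :|: r (rev_ord ord0).
  apply/existsP; rewrite -negb_forall; apply/negP => /forallP h.
  have : [set: 'I_N] \subset r ord0 :|: r (rev_ord ord0).
    by apply/subsetP => j _; exact: h.
  move=> /subset_leq_card; rewrite cardsT card_columns.
  have := cardsU (r ord0) (r (rev_ord ord0)).
  have := r1 ord0; have := r1 (rev_ord ord0); lia.
have jrA k : column_facet (k, j) \in A.
  have : remaining r (face_of [set (k, j)]).
    split=> [|k' j' jr']; first exact: polar_vertex.
    rewrite mem_face_of inE; apply/negP => /eqP[kk jj]; move: jr jr'.
    rewrite kk jj inE negb_or; have [->|/ord2_neq->] := eqVneq k ord0.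
      by move=> /andP[/negbTE->].
    by move=> /andP[_ /negbTE->].
  by rewrite eA /= sub_face_of => /forall_inP; apply; rewrite inE.
have : remaining r (face_of [set (ord0, j); (rev_ord ord0, j)]).
  rewrite eA /= sub_face_of; apply/forall_inP => p.
  by rewrite !inE => /orP[] /eqP->.
by move=> [CA _]; have := @polar_column _ ord0 j CA; rewrite !inE !eqxx orbT => /(_ isT).
Qed.

(** * Induction along a shedding sequence *)

(** Complexes of the form [remaining r] are stable under shedding a vertex, which lets the induction
    run over [r]. *)
Lemma antistar_remaining r i j :
  antistar (remaining r) (face_of [set (i, j)]) =
  remaining (fun k => if k == i then j |: r k else r k).
Proof.
apply/seteqP; split=> T; rewrite /antistar/= sub_face_of.
  move=> [[CT rT] ijT]; split=> // k l.
  case: eqP => [->|_]; last exact: rT.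
  rewrite !inE => /orP[/eqP->|]; last exact: rT.
  apply: contra ijT => ijT; apply/forall_inP => p.
  by rewrite inE => /eqP->.
move=> [CT rT]; split.
  by split=> // k l lr; apply: rT; case: eqP => // _; rewrite inE lr orbT.
apply/negP => /forall_inP/(_ (i, j)); rewrite inE eqxx => /(_ isT).
by apply/negP/rT; rewrite eqxx !inE eqxx.
Qed.

Lemma weakly_decomposable_pure (V : choiceType) k (D : set {fset V}) :
  weakly_decomposable k D -> pure D.
Proof. by case. Qed.

(** The face [S] records that the dimension has not dropped below [2 * m - 1]; it and the bound on
    [r] are the invariants of the induction. *)
Lemma remaining_not_decomposable r D S :
  D = remaining r -> (forall i, #|r i| <= 1)%N ->
  remaining r S -> (2 * m <= #|` S|)%N -> ~ weakly_vertex_decomposable D.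
Proof.
move=> eD r1 rS cS wD; elim: wD r S eD r1 rS cS => {}D.
  by move=> _ sD r S eD r1 _ _; apply: (remaining_not_simplex r1); rewrite -eD.
move=> d t pD [_ Dd] Dt t0 [[S' tS' dS'] _] wt IH r S eD r1 rS cS.
have [Ct _] : remaining r t by rewrite -eD.
have [T eT] : exists T, t = face_of T by eexists; exact: polarE Ct.
(* The shed face is a single vertex: its dimension is at most 0, and shedding the empty face would
   leave no face at all, against [S']. *)
have /cards1P[[i j] eij] : #|T| == 1%N.
  rewrite eqn_leq -card_face_of -eT; apply/andP; split.
    by move: t0; rewrite /face_dim; lia.
  rewrite cardfs_gt0; apply/negP => /eqP te.
  by move: tS'; rewrite te => -[_]; rewrite fsub0set.
have er := antistar_remaining r i j; rewrite -eD -eij -eT in er.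
have cS' : (2 * m <= #|` S'|)%N.
  by have := Dd S; rewrite eD => /(_ rS); move: dS'; rewrite /face_dim; lia.
apply: (IH _ S' er) => //; last by rewrite -er.
move=> k; set r' := (r' in remaining r') in er; rewrite -/(r' k).
(* Row [i] may now have two deleted vertices and the other row one, at most 3 in all; purity of the
   antistar brings the bound back to one per row. *)
apply: (@pure_remaining r' k S'); rewrite -?er// /r'.
  exact: weakly_decomposable_pure wt.
have cU : (#|j |: r i| <= 2)%N by rewrite cardsU1 (leq_add (leq_b1 _) (r1 i)).
have [->|/ord2_neq->] := eqVneq k i.
  by rewrite rev_ord_neq (leq_add cU (r1 _)).
by rewrite rev_ordK eqxx addnC (leq_add cU (r1 _)).
Qed.

Lemma polar_not_decomposable : ~ weakly_vertex_decomposable C.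
Proof.
have [B _ cB] : exists2 B : {set 'I_N}, B \subset setT & #|B| = m.
  by apply: subset_of_card; rewrite cardsT card_columns; lia.
have [A AB cA] : exists2 A : {set 'I_N}, A \subset ~: B & #|A| = m.
  by apply: subset_of_card; have := cardsC B; rewrite card_columns; lia.
(* A face with [m] vertices in each row starts the induction, with nothing deleted. *)
have CAB : C (face_of [set p | p.2 \in (if p.1 == ord0 then A else B)]).
  by apply: polar_pair; [rewrite disjoints_subset|rewrite cA cB].
have eC : C = remaining (fun=> set0).
  by apply/seteqP; split=> [T CT|T []//]; split=> // i j; rewrite inE.
apply: (remaining_not_decomposable eC) => [i||].
- by rewrite cards0.
- by rewrite -eC; exact: CAB.
rewrite card_face_of (card_rows _ ord0).
have -> : row_of [set p | p.2 \in (if p.1 == ord0 then A else B)] ord0 = A.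
  by apply/setP => j; rewrite !inE eqxx.
have -> : row_of [set p | p.2 \in (if p.1 == ord0 then A else B)] (rev_ord ord0) = B.
  by apply/setP => j; rewrite !inE rev_ord_neq.
by rewrite cA cB; lia.
Qed.

End TwoRows.

Theorem theorem3p1 (R : realType) (m : nat) (hm : (3 <= m)%N) :
  ~ weakly_vertex_decomposable
      (polar_complex
         (transportation_polytope
            (const_mx (2 * m + 1)%:R : 'rV[R]_2)
            (const_mx 2%:R : 'rV[R]_(2 * m + 1)))).
Proof. exact/polar_not_decomposable/ltnW. Qed.
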